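(* Let $Y$ be a random variable whose moment generating function $E[e^{tY}]$ exists for $|t|<r_0$ for some $r_0>0$. Let $(Y_j)_{j\ge1}$ be mutually independent copies of $Y$, $S_0=0$, $S_k=Y_1+\cdots+Y_k$ for $k\ge1$. Let $r$ be a positive integer and define $\phi_{n,r}^Y(x,y)$ by $$\Big(1+y\big(E[e^{Yt}]-1\big)\Big)^{x}e^{rt}=\sum_{n=0}^{\infty}\phi_{n,r}^Y(x,y)\frac{t^n}{n!}.$$ Then for all integers $m,n\ge0$, $$\phi_{m+n,r}^Y(x,y)=\sum_{i=0}^{n}\sum_{k=0}^{m}\binom{n}{i}\phi_{i,r}^Y(x-k,y)\frac{(x)_k y^k}{k!}\sum_{j=k}^{m}\sum_{l_1+\cdots+l_k=j}\binom{m}{j}\binom{j}{l_1,\dots,l_k}r^{m-j}E\Big[S_k^{n-i}\prod_{p=1}^{k}Y_p^{l_p}\Big],$$ where the innermost sum runs over $k$-tuples $(l_1,\dots,l_k)$ of positive integers with sum $j$.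
   Context: $(x)_0=1$, $(x)_k=x(x-1)\cdots(x-k+1)$ for $k\ge1$. The power $(1+u)^x$ is understood via the binomial series $\sum_{k\ge0}\binom{x}{k}u^k$ and the defining identity is one of power series in $t$; $x,y$ are variables. For $k=0$ the sum over $(l_1,\dots,l_k)$ equals $1$ if $j=0$ and $0$ otherwise (empty product equal to $1$). $\binom{j}{l_1,\dots,l_k}$ is the multinomial coefficient. *)

(* Defs.v *)
From HB Require Import structures.
From mathcomp Require Import all_boot all_order all_algebra.
From mathcomp Require Import all_classical all_reals all_analysis.
Set Implicit Arguments. Unset Strict Implicit. Unset Printing Implicit Defensive.
Import Order.TTheory GRing.Theory Num.Theory.
Local Open Scope classical_set_scope.
Local Open Scope ring_scope.

Section FPS.
Variable R : realType.
Definition fps := nat -> R.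
Definition fone : fps := fun n => (n == 0%N)%:R.
Definition fmul (a b : fps) : fps := fun n => \sum_(i < n.+1) a i * b (n - i)%N.
Definition fpow (a : fps) (k : nat) : fps := iter k (fmul a) fone.
Definition fscale (c : R) (a : fps) : fps := fun n => c * a n.
Definition fsub (a b : fps) : fps := fun n => a n - b n.
Definition falling (x : R) (k : nat) : R := \prod_(i < k) (x - i%:R).
Definition binr (x : R) (k : nat) : R := falling x k / (k`!)%:R.
(* (1+u)^x := sum_k binom(x,k) u^k, for u with zero constant term;
   the coefficient of t^n only involves k <= n (u^k has order >= k). *)
Definition fbinpow (u : fps) (x : R) : fps :=
  fun n => \sum_(k < n.+1) binr x k * fpow u k n.
Definition fexp (c : R) : fps := fun n => c ^+ n / (n`!)%:R.
End FPS.

Section Prob.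
Context {d : measure_display} {T : measurableType d} {R : realType}.
Variable P : probability T R.

Definition Er (X : T -> R) : R := fine ('E_P[X])%E.

Definition mgf_exists_near0 (Y : T -> R) : Prop :=
  exists r0 : R, 0 < r0 /\
    forall t : R, `|t| < r0 -> P.-integrable setT (fun w => (expR (t * Y w))%:E).

Definition mgf_series (Y : T -> R) : fps R :=
  fun n => Er (fun w => Y w ^+ n) / (n`!)%:R.

Definition mutually_independent (Ys : nat -> T -> R) : Prop :=
  forall (J : seq nat) (B : nat -> set R),
    uniq J -> (forall j, measurable (B j)) ->
    P (\big[setI/setT]_(j <- J) (Ys j @^-1` B j)) =
    (\prod_(j <- J) P (Ys j @^-1` B j))%E.

Definition same_law (X Y : T -> R) : Prop :=
  forall B : set R, measurable B -> P (X @^-1` B) = P (Y @^-1` B).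

Definition phi (Y : T -> R) (r : nat) (n : nat) (x y : R) : R :=
  (n`!)%:R *
  fmul (fbinpow (fscale y (fsub (mgf_series Y) (fone R))) x) (fexp r%:R) n.
End Prob.

Definition multinom (k j : nat) (l : {ffun 'I_k -> 'I_j.+1}) : nat :=
  j`! %/ \prod_(p < k) (l p)`!.

(* Main.v *)
Require Import Defs.
From HB Require Import structures.
From mathcomp Require Import all_boot all_order all_algebra.
From mathcomp Require Import all_classical all_reals all_analysis.
From mathcomp Require Import measurable_realfun ring lra.
Set Implicit Arguments. Unset Strict Implicit.
Unset Printing Implicit Defensive.
Import Order.TTheory GRing.Theory Num.Theory.
Local Open Scope classical_set_scope.
Local Open Scope ring_scope.

(** Write [f(t) = E[e^(tY)]], [u = y (f - 1)] and [Phi_x = (1 + u)^x e^(rt)].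
    From [1 + u(t + s) = (1 + u(t)) + (u(t + s) - u(t))], the binomial series in
    the increment gives
      [Phi_x(t + s) =
         sum_k binom(x, k) Phi_(x - k)(t) (u(t + s) - u(t))^k e^(rs)],
    and by independence
      [(u(t + s) - u(t))^k = y^k E[e^(S_k t) prod_p (e^(Y_p s) - 1)]].
    The theorem compares the coefficients of [t^n/n! s^m/m!]. Exponential
    generating functions are represented by their sequences of coefficients
    [a_n] of [t^n/n!] (Hurwitz series), so that differentiation is the shift of
    sequences and no division is needed; series in [s] and [t] are Hurwitz
    series over Hurwitz series. The first expansion is proved coefficientwise
    in [s], i.e. as a formula for the [m]-th derivative of [Phi_x], by induction
    on [m]. *)

(** * Hurwitz series *)

Definition hurwitz (A : Type) : Type := nat -> A.

Section HurwitzRing.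
Variable A : comNzRingType.
Implicit Types a b c : hurwitz A.

HB.instance Definition _ := gen_eqMixin (hurwitz A).
HB.instance Definition _ := gen_choiceMixin (hurwitz A).

Definition hadd a b : hurwitz A := fun n => a n + b n.
Definition hopp a : hurwitz A := fun n => - a n.
Definition hzero : hurwitz A := fun=> 0.

Fact haddA : associative hadd.
Proof. by move=> a b c; apply/funext => n; rewrite /hadd addrA. Qed.
Fact haddC : commutative hadd.
Proof. by move=> a b; apply/funext => n; rewrite /hadd addrC. Qed.
Fact hadd0 : left_id hzero hadd.
Proof. by move=> a; apply/funext => n; rewrite /hadd add0r. Qed.
Fact haddN : left_inverse hzero hopp hadd.
Proof. by move=> a; apply/funext => n; rewrite /hadd /hopp addNr. Qed.

HB.instance Definition _ :=
  GRing.isZmodule.Build (hurwitz A) haddA haddC hadd0 haddN.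

Lemma hurwitzD a b n : (a + b) n = a n + b n. Proof. by []. Qed.
Lemma hurwitzN a n : (- a) n = - a n. Proof. by []. Qed.
Lemma hurwitz0 n : (0 : hurwitz A) n = 0. Proof. by []. Qed.

Definition hshift a : hurwitz A := fun n => a n.+1.
Definition hconst (x : A) : hurwitz A := fun n => if n is 0 then x else 0.
Definition hmul a b : hurwitz A :=
  fun n => \sum_(i < n.+1) 'C(n, i)%:R * (a i * b (n - i)%N).

Lemma hmul_0 a b : hmul a b 0 = a 0%N * b 0%N.
Proof. by rewrite /hmul big_ord1 bin0 mul1r. Qed.

(* Products are determined by their constant terms and the Leibniz rule, so
   ring identities follow by induction on the index of the coefficient. *)
Lemma hmul_S a b n : hmul a b n.+1 = hmul (hshift a) b n + hmul a (hshift b) n.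
Proof.
(* The sum is padded with the index [n.+1], whose binomial coefficient is zero, so that Pascal's
   rule can merge the two sums term by term. *)
have -> : hmul a (hshift b) n =
    \sum_(i < n.+2) 'C(n, i)%:R * (a i * b (n.+1 - i)%N).
  rewrite big_ord_recr /= bin_small // mul0r addr0.
  by apply: eq_bigr => i _; rewrite /hshift -subSn // -ltnS.
rewrite [RHS]addrC /hmul big_ord_recl [in RHS]big_ord_recl !bin0 -addrA.
congr (_ + _).
rewrite -big_split /=; apply: eq_bigr => i _.
by rewrite /bump add1n binS subSS natrD mulrDl.
Qed.

Lemma hshift_hmul a b :
  hshift (hmul a b) = hmul (hshift a) b + hmul a (hshift b).
Proof. by apply/funext => n; exact: hmul_S. Qed.

Fact hmulC : commutative hmul.
Proof.
move=> a b; apply/funext => n.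
elim: n a b => [|n IHn] a b; first by rewrite !hmul_0 mulrC.
by rewrite !hmul_S (IHn a) (IHn (hshift a)) addrC.
Qed.

Fact hmulDl : left_distributive hmul hadd.
Proof.
move=> a b c; apply/funext => n; rewrite /hmul /hadd -big_split /=.
by apply: eq_bigr => i _; rewrite mulrDl mulrDr.
Qed.

Fact hmulA : associative hmul.
Proof.
move=> a b c; apply/funext => n.
elim: n a b c => [|n IHn] a b c; first by rewrite !hmul_0 mulrA.
have hmulDr x y z : hmul x (y + z) = hmul x y + hmul x z.
  by rewrite hmulC [LHS](hmulDl y z x) (hmulC y) (hmulC z).
rewrite !hmul_S !hshift_hmul hmulDr.
rewrite [X in _ = X + _](congr1 (@^~ n) (hmulDl _ _ _)).
by rewrite hurwitzD /hadd !IHn addrA.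
Qed.

Fact hmul1 : left_id (hconst 1) hmul.
Proof.
move=> a; apply/funext => n; rewrite /hmul big_ord_recl bin0 !mul1r subn0.
by rewrite big1 ?addr0 // => i _; rewrite /hconst /= mul0r mulr0.
Qed.

Fact hone_neq0 : hconst 1 != 0.
Proof.
by apply/eqP => /(congr1 (@^~ 0%N)) /eqP; rewrite hurwitz0 /= oner_eq0.
Qed.

HB.instance Definition _ := GRing.Zmodule_isComNzRing.Build (hurwitz A)
  hmulA hmulC hmul1 hmulDl hone_neq0.

Lemma hurwitzM a b n :
  (a * b) n = \sum_(i < n.+1) 'C(n, i)%:R * (a i * b (n - i)%N).
Proof. by []. Qed.

Lemma hurwitzM_0 a b : (a * b) 0%N = a 0%N * b 0%N.
Proof. exact: hmul_0. Qed.

Lemma hurwitz1 n : (1 : hurwitz A) n = (n == 0%N)%:R.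
Proof. by case: n. Qed.

Lemma hurwitz_sum I (s : seq I) (Q : pred I) (F : I -> hurwitz A) n :
  (\sum_(i <- s | Q i) F i) n = \sum_(i <- s | Q i) F i n.
Proof. exact: (big_morph (fun a : hurwitz A => a n)). Qed.

Lemma hshift0 : hshift 0 = 0. Proof. by []. Qed.

Lemma hshift_sum I (s : seq I) (Q : pred I) (F : I -> hurwitz A) :
  hshift (\sum_(i <- s | Q i) F i) = \sum_(i <- s | Q i) hshift (F i).
Proof. exact: (big_morph hshift). Qed.

Lemma hshiftM a b : hshift (a * b) = hshift a * b + a * hshift b.
Proof. exact: hshift_hmul. Qed.

Lemma hconst_mulE x a n : (hconst x * a) n = x * a n.
Proof.
rewrite hurwitzM big_ord_recl bin0 mul1r subn0.
by rewrite big1 ?addr0 // => i _; rewrite /hconst /= mul0r mulr0.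
Qed.

Lemma hconstM : {morph hconst : x y / x * y}.
Proof.
move=> x y; apply/funext => n; rewrite hconst_mulE.
by case: n => //= n; rewrite mulr0.
Qed.

Lemma hconst_is_zmod_morphism : zmod_morphism hconst.
Proof.
by move=> x y; apply/funext => -[|n]; rewrite hurwitzD hurwitzN //= subrr.
Qed.

Lemma hconst_is_monoid_morphism : monoid_morphism hconst.
Proof. by split=> // x y; exact: hconstM. Qed.

HB.instance Definition _ :=
  GRing.isZmodMorphism.Build A (hurwitz A) hconst hconst_is_zmod_morphism.
HB.instance Definition _ :=
  GRing.isMonoidMorphism.Build A (hurwitz A) hconst hconst_is_monoid_morphism.

Lemma hshift_const x : hshift (hconst x) = 0. Proof. by []. Qed.

Lemma hurwitz_natl k a n : (k%:R * a) n = k%:R * a n.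
Proof. by rewrite -(rmorph_nat hconst) hconst_mulE. Qed.

Lemma hshift_constM x a : hshift (hconst x * a) = hconst x * hshift a.
Proof. by rewrite hshiftM hshift_const mul0r add0r. Qed.

Lemma hshiftX a k : hshift (a ^+ k) = k%:R * (hshift a * a ^+ k.-1).
Proof.
elim: k => [|[|k] IHk].
- by rewrite expr0 mul0r -(rmorph1 hconst) hshift_const.
- by rewrite expr1 expr0 mulr1 mul1r.
rewrite exprS hshiftM IHk /= mulrCA (mulrCA a) -exprS -[k.+2]addn1 natrD.
by rewrite mulrDl mul1r addrC.
Qed.

(** A series without constant term has a [k]-th power of order at least [k]: its derivative is $k a'
    a^{k-1}$, and the coefficients of $a^{k-1}$ that enter have index at most [n], one less than
    before. *)
Lemma hurwitzX_small a k n : a 0%N = 0 -> (n < k)%N -> (a ^+ k) n = 0.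
Proof.
move=> a0; elim/ltn_ind: n k => -[|n] IHn [|k] // ltnk.
  by rewrite exprS hurwitzM_0 a0 mul0r.
rewrite -[LHS]/(hshift (a ^+ k.+1) n) hshiftX hurwitz_natl hurwitzM.
rewrite big1 ?mulr0 // => i _; rewrite [X in _ * (_ * X)]IHn ?mulr0 //.
  by rewrite ltnS leq_subr.
by rewrite (leq_ltn_trans (leq_subr _ _)).
Qed.

(** The series $e^{xt}$. *)
Definition hexp (x : A) : hurwitz A := fun n => x ^+ n.

Lemma hshift_exp x : hshift (hexp x) = hconst x * hexp x.
Proof. by apply/funext => n; rewrite hconst_mulE /hshift /hexp exprS. Qed.

Lemma hexpD x y : hexp (x + y) = hexp x * hexp y.
Proof.
apply/funext => n; rewrite hurwitzM /hexp addrC exprDn.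
by apply: eq_bigr => i _; rewrite mulr_natl mulrC.
Qed.

Lemma hexp0 : hexp 0 = 1.
Proof. by apply/funext => n; rewrite hurwitz1 /hexp expr0n. Qed.

Lemma hexp_sum I (s : seq I) (Q : pred I) (F : I -> A) :
  hexp (\sum_(i <- s | Q i) F i) = \prod_(i <- s | Q i) hexp (F i).
Proof. exact: (big_morph hexp hexpD hexp0). Qed.

(* The divided power t^e / e!. *)
Definition hdpow (e : nat) : hurwitz A := fun n => (n == e)%:R.

Lemma hdpow0 : hdpow 0 = 1.
Proof. by apply/funext => n; rewrite hurwitz1. Qed.

Lemma hshift_dpowS e : hshift (hdpow e.+1) = hdpow e. Proof. by []. Qed.

Lemma hdpowM e f : hdpow e * hdpow f = 'C(e + f, e)%:R * hdpow (e + f).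
Proof.
apply/funext => n; rewrite hurwitz_natl.
elim: n e f => [|n IHn] [|e] [|f];
  rewrite ?hdpow0 ?mul1r ?mulr1 ?bin0 ?addn0 ?binn ?mul1r ?hurwitz1 //.
  by rewrite hurwitzM_0 /hdpow mul0r !addnS mulr0.
rewrite -[LHS]/(hshift (hdpow e.+1 * hdpow f.+1) n) hshiftM !hshift_dpowS.
rewrite hurwitzD !IHn.
by rewrite [(e.+1 + f)%N]addSnnS addSn binS natrD mulrDl addrC.
Qed.

Lemma hdpow_prod k (l : 'I_k -> nat) :
  \prod_(p < k) hdpow (l p) =
  ((\sum_(p < k) l p)`! %/ \prod_(p < k) (l p)`!)%:R * hdpow (\sum_(p < k) l p).
Proof.
(* Naming the multinomial coefficient [c] through a multiplicative equation postpones the Euclidean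
   quotient, which is exact for that reason. *)
have [c [eq_c ->]] : exists c : nat,
    (c * \prod_(p < k) (l p)`! = (\sum_(p < k) l p)`!)%N /\
    \prod_(p < k) hdpow (l p) = c%:R * hdpow (\sum_(p < k) l p).
  elim: k l => [|k IHk] l.
    by exists 1%N; rewrite !big_ord0 mul1r hdpow0.
  have [c [eq_c eq_p]] := IHk (fun p => l (widen_ord (leqnSn k) p)).
  rewrite !big_ord_recr /= eq_p; set s := (\sum_(i < k) _)%N in eq_c *.
  exists (c * 'C(s + l ord_max, s))%N; split.
    rewrite -(bin_fact (leq_addr (l ord_max) s)) addKn -eq_c.
    by ring.
  by rewrite -mulrA hdpowM mulrA natrM.
rewrite -eq_c mulnK //; apply: prodn_gt0 => p; exact: fact_gt0.
Qed.

(** The coefficient of index [j] only depends on coefficients of index at most [j]. Each factor may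
    thus be truncated to a finite combination of divided powers, and the product expands by
    distributivity. *)
Lemma hurwitz_prod_coef k (h : 'I_k -> hurwitz A) j :
  (\prod_(p < k) h p) j =
  \sum_(l : {ffun 'I_k -> 'I_j.+1} | (\sum_(p < k) (l p : nat) == j)%N)
    (j`! %/ \prod_(p < k) (l p)`!)%:R * \prod_(p < k) h p (l p).
Proof.
pose trunc (a : hurwitz A) := \sum_(e < j.+1) hconst (a e) * hdpow e.
have truncE a n : (n <= j)%N -> trunc a n = a n.
  move=> lenj; rewrite /trunc hurwitz_sum.
  rewrite (bigD1 (Ordinal (lenj : n < j.+1)%N)) //=.
  rewrite hconst_mulE /hdpow eqxx mulr1 big1 ?addr0 // => e ne.
  rewrite hconst_mulE -(inj_eq val_inj) /= eq_sym in ne *.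
  by rewrite (negbTE ne) mulr0.
have -> : (\prod_(p < k) h p) j = (\prod_(p < k) trunc (h p)) j.
  pose eqj (a b : hurwitz A) := forall n, (n <= j)%N -> a n = b n.
  suff : eqj (\prod_(p < k) h p) (\prod_(p < k) trunc (h p)) by exact.
  apply: (big_ind2 eqj) => //.
    move=> a a' b b' ha hb n lenj; rewrite !hurwitzM; apply: eq_bigr => i _.
    rewrite ha ?hb // ?(leq_trans (leq_subr _ _)) //.
    by rewrite (leq_trans _ lenj) // -ltnS.
  by move=> p _ n lenj; rewrite truncE.
rewrite /trunc bigA_distr_bigA /= hurwitz_sum [RHS]big_mkcond /=.
apply: eq_bigr => l _; rewrite big_split /= hdpow_prod -rmorph_prod /=.
rewrite hconst_mulE hurwitz_natl /hdpow eq_sym.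
by case: eqP => [->|_]; rewrite ?mulr1 ?mulr0 // mulrC.
Qed.
End HurwitzRing.

(** * The derivatives of (1 + u)^x e^(ct) *)

Section FpsToHurwitz.
Variable R : realType.
Implicit Types (a b : fps R) (c x : R) (u : hurwitz R).

(** Passage from the coefficients of $t^n$ to those of $t^n/n!$. *)
Definition hurwitz_of_fps a : hurwitz R := fun n => (n`!)%:R * a n.

Lemma hurwitz_of_fpsM a b :
  hurwitz_of_fps (fmul a b) = hurwitz_of_fps a * hurwitz_of_fps b.
Proof.
apply/funext => n; rewrite hurwitzM /hurwitz_of_fps /fmul mulr_sumr.
apply: eq_bigr => i _; rewrite -(bin_fact (ltn_ord i : (i <= n)%N)) !natrM.
by ring.
Qed.

Lemma hurwitz_of_fpsX a k :
  hurwitz_of_fps (fpow a k) = hurwitz_of_fps a ^+ k.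
Proof.
elim: k => [|k IHk].
  apply/funext => -[|n]; rewrite expr0 hurwitz1 /hurwitz_of_fps /fpow /fone /=.
    by rewrite mulr1.
  by rewrite mulr0.
by rewrite exprS -IHk -hurwitz_of_fpsM.
Qed.

Lemma hurwitz_of_fexp c : hurwitz_of_fps (fexp c) = hexp c.
Proof.
apply/funext => n; rewrite /hurwitz_of_fps /fexp mulrC.
by rewrite divfK ?pnatr_eq0 -?lt0n ?fact_gt0.
Qed.

Definition hbinpow (u : hurwitz R) x : hurwitz R :=
  fun n => \sum_(k < n.+1) binr x k * (u ^+ k) n.

Lemma hurwitz_of_fbinpow a x :
  hurwitz_of_fps (fbinpow a x) = hbinpow (hurwitz_of_fps a) x.
Proof.
apply/funext => n; rewrite /hurwitz_of_fps /fbinpow /hbinpow mulr_sumr.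
by apply: eq_bigr => k _; rewrite -hurwitz_of_fpsX mulrCA.
Qed.

Lemma binrS x k : binr x k.+1 * k.+1%:R = (x - k%:R) * binr x k.
Proof.
rewrite /binr /falling big_ord_recr factS natrM /=.
by field; rewrite nat1r !pnatr_eq0 -lt0n fact_gt0.
Qed.

(** The first factor of the falling factorial is split off here, the last one in [binrS]. This form
    serves the chain rule for $(1+u)^x$, the other one the induction on the order of the
    derivative. *)
Lemma binrS1 x k : binr x k.+1 * k.+1%:R = x * binr (x - 1) k.
Proof.
rewrite /binr /falling big_ord_recl factS natrM subr0.
under eq_bigr => i _ do rewrite lift0 -nat1r opprD addrA.
by field; rewrite nat1r !pnatr_eq0 -lt0n fact_gt0.
Qed.

(** The added terms vanish because $u^k$ has order at least $k$. A bound independent of the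
    coefficient allows sums to be exchanged. *)
Lemma hbinpow_widen u x n N : u 0%N = 0 -> (n <= N)%N ->
  hbinpow u x n = \sum_(k < N.+1) binr x k * (u ^+ k) n.
Proof.
move=> u0 lenN; rewrite /hbinpow.
rewrite (big_ord_widen N.+1 (fun k => binr x k * (u ^+ k) n)) //.
rewrite big_mkcond; apply: eq_bigr => k _; case: ltnP => // ltnk.
by rewrite hurwitzX_small // mulr0.
Qed.

(** Chain rule $((1+u)^x)' = x u' (1+u)^{x-1}$, obtained by differentiating the binomial series term
    by term. *)
Lemma hshift_hbinpow u x : u 0%N = 0 ->
  hshift (hbinpow u x) = hconst x * (hshift u * hbinpow u (x - 1)).
Proof.
move=> u0; apply/funext => n; rewrite hconst_mulE hurwitzM.
under [in RHS]eq_bigr => i _ do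
  rewrite (hbinpow_widen _ u0 (leq_subr i n)) mulr_sumr mulr_sumr.
rewrite exchange_big mulr_sumr /hshift /hbinpow big_ord_recl /=.
rewrite expr0 hurwitz1 mulr0 add0r; apply: eq_bigr => k _.
rewrite /bump add1n -[(u ^+ k.+1) _]/(hshift (u ^+ k.+1) n) hshiftX.
rewrite hurwitz_natl mulrA binrS1 -mulrA; congr (_ * _).
rewrite hurwitzM mulr_sumr.
by apply: eq_bigr => i _; rewrite /hshift /=; ring.
Qed.

(** * Taylor expansion in a second variable *)

Section DoubleSeries.
Variables (u : hurwitz R) (c : R).
Hypothesis u0 : u 0%N = 0.

Definition hbinexp x : hurwitz R := hbinpow u x * hexp c.

Lemma hshift_hbinexp x : hshift (hbinexp x) =
  hconst x * (hshift u * hbinexp (x - 1)) + hconst c * hbinexp x.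
Proof. by rewrite hshiftM hshift_hbinpow // hshift_exp /hbinexp; ring. Qed.

(* A series in a second variable s whose coefficients are series in t;
   [hincr] is u(t + s) - u(t). *)
Definition hincr : hurwitz (hurwitz R) :=
  fun n => if n is 0 then 0 else iter n (@hshift R) u.

Lemma hincr0 : hincr 0%N = 0. Proof. by []. Qed.

(** The series $(u(t+s)-u(t))^k e^{cs}$. *)
Definition hincrpow k : hurwitz (hurwitz R) := hincr ^+ k * hexp (hconst c).

(** Differentiation in $t$, whereas [hshift] on double series is differentiation in $s$. *)
Definition inner_hshift (a : hurwitz (hurwitz R)) : hurwitz (hurwitz R) :=
  fun n => hshift (a n).

Lemma inner_hshiftM (a b : hurwitz (hurwitz R)) :
  inner_hshift (a * b) = inner_hshift a * b + a * inner_hshift b.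
Proof.
apply/funext => n; rewrite /inner_hshift hurwitzD !hurwitzM hshift_sum.
rewrite -big_split; apply: eq_bigr => i _ /=.
by rewrite -(rmorph_nat (@hconst R)) hshift_constM hshiftM mulrDr.
Qed.

(** The derivatives of $u(t+s)$ in $s$ and in $t$ agree, so those of the increment differ by
    $u'(t)$. *)
Lemma hshift_hincr : hshift hincr = inner_hshift hincr + hconst (hshift u).
Proof.
apply/funext => -[|n]; rewrite hurwitzD /inner_hshift /hshift /=.
  by apply/funext => n; rewrite hurwitzD hurwitz0 add0r.
by rewrite addr0.
Qed.

Lemma hshift_hincrX k : hshift (hincr ^+ k) =
  inner_hshift (hincr ^+ k) + k%:R * (hconst (hshift u) * hincr ^+ k.-1).
Proof.
elim: k => [|[|k] IHk].
- by rewrite expr0 mul0r addr0; apply/funext => -[|n].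
- by rewrite !expr1 expr0 mulr1 mul1r hshift_hincr.
rewrite exprS hshiftM IHk hshift_hincr inner_hshiftM /=.
by rewrite -[k.+2]addn1 natrD exprS; ring.
Qed.

Lemma inner_hshift_exp : inner_hshift (hexp (hconst c)) = 0.
Proof.
by apply/funext => n; rewrite /inner_hshift /hexp -rmorphXn hshift_const.
Qed.

(** Product rule in $s$, with derivatives in $s$ traded for derivatives in $t$. For [k = 0] the
    value of [k.-1] is harmless, since the factor [k%:R] is zero. *)
Lemma hincrpowS k m : hincrpow k m.+1 = hshift (hincrpow k m) +
  k%:R * (hshift u * hincrpow k.-1 m) + hconst c * hincrpow k m.
Proof.
have -> : hincrpow k m.+1 = hshift (hincrpow k) m by [].
have -> : hshift (hincrpow k m) = inner_hshift (hincrpow k) m by [].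
rewrite /hincrpow hshiftM hshift_hincrX hshift_exp inner_hshiftM.
rewrite inner_hshift_exp mulr0 addr0 -(hconst_mulE (hshift u)).
rewrite -(hconst_mulE (hconst c)) -(hurwitz_natl k) -!hurwitzD.
apply: (congr1 (fun a : hurwitz (hurwitz R) => a m)); ring.
Qed.

Lemma hincrpow_small k m : (m < k)%N -> hincrpow k m = 0.
Proof.
move=> ltmk; rewrite /hincrpow hurwitzM big1 // => i _.
rewrite hurwitzX_small ?mul0r ?mulr0 //.
exact: leq_trans (ltn_ord i) ltmk.
Qed.

Lemma iter_hshift_hbinexp x m : iter m (@hshift R) (hbinexp x) =
  \sum_(k < m.+1) hconst (binr x k) * (hbinexp (x - k%:R) * hincrpow k m).
Proof.
elim: m => [|m IHm].
  rewrite big_ord1 /binr /falling big_ord0 divr1 rmorph1 mul1r subr0.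
  by rewrite /hincrpow hurwitzM_0 expr0 /hexp expr0 hurwitz1 !mulr1.
rewrite iterS IHm hshift_sum.
under [RHS]eq_bigr => k _ do rewrite hincrpowS -addrA addrCA !mulrDr.
(* The terms with $u'$ form the first sum, which loses [k = 0] to its factor [k%:R]; the second
   loses [k = m.+1] by the order of the increment. After this shift of index both run over the range
   of the left side, and [binrS] matches the coefficients. *)
rewrite [RHS]big_split /= [X in _ = X + _]big_ord_recl /= mulr0n mul0r.
rewrite !mulr0 add0r.
rewrite [X in _ = _ + X]big_ord_recr /= hincrpow_small // hshift0.
rewrite !mulr0 !addr0 -big_split; apply: eq_bigr => k _ /=.
rewrite hshift_constM hshiftM hshift_hbinexp /bump add1n.
have key : hconst (binr x k.+1) * k.+1%:R =
    hconst (x - k%:R) * hconst (binr x k).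
  by rewrite -(rmorph_nat (@hconst R)) -[LHS]hconstM binrS hconstM.
have -> : x - k.+1%:R = x - k%:R - 1 by rewrite -nat1r; ring.
move: (x - k%:R - 1) => y.
rewrite [in RHS](mulrCA (hbinexp y)) (mulrA _ k.+1%:R) key /=; ring.
Qed.
End DoubleSeries.
End FpsToHurwitz.

(** * Moments of products of independent variables *)

Section ProductWithIndependentFactor.
Context {d : measure_display} {T : measurableType d} {R : realType}.
Variable P : probability T R.
Import HBNNSimple.
Local Open Scope ereal_scope.

(** The identity for indicators passes to simple functions by linearity and to [g] by monotone
    convergence. *)
Lemma ge0_integral_comp_indep (W : {RV P >-> R}) (Z : T -> R) (c : R) :
  (forall w, (0 <= Z w)%R) -> measurable_fun setT Z -> (0 <= c)%R ->
  (forall B, measurable B ->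
    \int[P]_w (\1_B (W w) * Z w)%:E = P (W @^-1` B) * c%:E) ->
  forall g : R -> R, (forall x, (0 <= g x)%R) -> measurable_fun setT g ->
    \int[P]_w (g (W w) * Z w)%:E = \int[P]_w (g (W w))%:E * c%:E.
Proof.
move=> Z0 mZ c0 indep g g0 mg.
have mEg : measurable_fun [set: R] (fun x => (g x)%:E).
  exact/measurable_EFinP.
have Eg0 x : [set: R] x -> 0 <= (g x)%:E by rewrite lee_fin.
pose h := nnsfun_approx measurableT mEg.
have cvgh x : (h n x)%:E @[n --> \oo] --> (g x)%:E.
  exact: (cvg_nnsfun_approx measurableT mEg Eg0).
have ndh x m n : (m <= n)%N -> (h m x <= h n x)%R.
  by move=> mn; exact/lefP/nd_nnsfun_approx.
have mhW n : measurable_fun setT (fun w => h n (W w)).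
  exact: measurableT_comp.
have lim1 : \int[P]_w (h n (W w) * Z w)%:E @[n --> \oo] -->
    \int[P]_w (g (W w) * Z w)%:E.
  rewrite (_ : \int[P]_w (g (W w) * Z w)%:E =
      \int[P]_w (limn (fun n => (h n (W w) * Z w)%:E))); last first.
    apply: eq_integral => w _; apply/esym/cvg_lim => //.
    under eq_fun do rewrite EFinM.
    by rewrite EFinM; apply: cvgeZr => //; exact: cvgh.
  apply: cvg_monotone_convergence => //.
  - by move=> n; apply/measurable_EFinP; apply: measurable_funM.
  - by move=> n w _; rewrite lee_fin mulr_ge0.
  - by move=> w _ m n mn; rewrite lee_fin ler_wpM2r // ndh.
have lim2 : \int[P]_w (h n (W w))%:E * c%:E @[n --> \oo] -->
    \int[P]_w (g (W w))%:E * c%:E.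
  apply: cvgeZr => //.
  rewrite (_ : \int[P]_w (g (W w))%:E =
      \int[P]_w (limn (fun n => (h n (W w))%:E))); last first.
    by apply: eq_integral => w _; apply/esym/cvg_lim => //; exact: cvgh.
  apply: cvg_monotone_convergence => //.
  - by move=> n; exact/measurable_EFinP.
  - by move=> n w _; rewrite lee_fin.
  - by move=> w _ m n mn; rewrite lee_fin ndh.
suff eqh n : \int[P]_w (h n (W w) * Z w)%:E = \int[P]_w (h n (W w))%:E * c%:E.
  by move: lim1; rewrite (funext eqh) => lim1; exact: cvg_unique lim1 lim2.
have indicW r : measurable_fun setT (fun w => \1_(h n @^-1` [set r]) (W w) : R).
  exact: measurableT_comp.
transitivity (\int[P]_w (\sum_(r \in range (h n))
    (r * (\1_(h n @^-1` [set r]) (W w) * Z w))%:E)).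
  apply: eq_integral => w _; rewrite fsumEFin // fimfunE mulr_fsuml //.
  by congr (_%:E); apply: eq_fsbigr => r _; rewrite mulrA.
(* This holds even for negative [r]: where the indicator is nonzero, [r] is a value of the
   nonnegative function [h n]. *)
have h0 r w (Z' : T -> R) : (forall w, (0 <= Z' w)%R) ->
    0 <= (r * (\1_(h n @^-1` [set r]) (W w) * Z' w))%:E.
  move=> Z'0; rewrite lee_fin indicE.
  case: (boolP (_ \in _)) => [|_]; last by rewrite mul0r mulr0.
  by rewrite inE /= => <-; rewrite mul1r mulr_ge0.
rewrite ge0_integral_fsum //; last 2 first.
- move=> r; apply/measurable_EFinP; apply: measurable_funM => //.
  exact: measurable_funM.
- by move=> r w _; exact: h0.
transitivity (\int[P]_w (\sum_(r \in range (h n))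
    (r * (\1_(h n @^-1` [set r]) (W w) * 1))%:E) * c%:E); last first.
  congr (_ * _); apply: eq_integral => w _; rewrite fsumEFin // fimfunE.
  by congr (_%:E); apply: eq_fsbigr => r _; rewrite mulr1.
rewrite ge0_integral_fsum //; last 2 first.
- move=> r; apply/measurable_EFinP; apply: measurable_funM => //.
  exact: measurable_funM.
- by move=> r w _; exact: (h0 r w (fun=> 1%R)).
rewrite ge0_mule_fsuml; last first.
  by move=> r; apply: integral_ge0 => w _; exact: (h0 r w (fun=> 1%R)).
apply: eq_fsbigr => r; rewrite inE => -[x _ hx].
have r0 : (0 <= r)%R by rewrite -hx.
under eq_integral do rewrite EFinM.
rewrite ge0_integralZl_EFin //; last 2 first.
- by move=> w _; rewrite lee_fin mulr_ge0.
- by apply/measurable_EFinP; exact: measurable_funM.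
rewrite indep //.
under [in RHS]eq_integral do rewrite mulr1 EFinM.
rewrite ge0_integralZl_EFin //; last exact/measurable_EFinP.
rewrite -muleA; congr (_ * (_ * _)).
rewrite (_ : (fun w => _) = (fun w => (\1_(W @^-1` (h n @^-1` [set r])) w)%:E)).
  rewrite integral_indic ?setIT //.
  by rewrite -[X in measurable X]setTI; apply: measurable_funP.
by apply/funext => w; rewrite !indicE.
Qed.

End ProductWithIndependentFactor.

Section Expectation.
Context {d : measure_display} {T : measurableType d} {R : realType}.
Variable P : probability T R.
Implicit Types X : T -> R.

Lemma ErE X : P.-integrable setT (EFin \o X) ->
  (\int[P]_w (X w)%:E)%E = (Er P X)%:E.
Proof.
by move=> iX; rewrite /Er unlock fineK //; exact: integrable_fin_num.
Qed.

Lemma Er_sum (I : Type) (s : seq I) (Q : pred I) (F : I -> T -> R) :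
  (forall i, P.-integrable setT (EFin \o F i)) ->
  Er P (fun w => \sum_(i <- s | Q i) F i w) = \sum_(i <- s | Q i) Er P (F i).
Proof.
move=> iF; rewrite {1}/Er unlock.
under eq_integral do rewrite -sumEFin.
rewrite integral_sum //; under eq_bigr do rewrite ErE //.
by rewrite sumEFin.
Qed.

Lemma Er_scale k X : P.-integrable setT (EFin \o X) ->
  Er P (fun w => k * X w) = k * Er P X.
Proof.
move=> iX; rewrite {1}/Er unlock; under eq_integral do rewrite EFinM.
by rewrite integralZl // ErE.
Qed.

Lemma Er_indic (A : set T) : measurable A -> (Er P \1_A)%:E = P A.
Proof.
by move=> mA; rewrite /Er expectation_indic // fineK // fin_num_measure.
Qed.

Lemma measurable_prod_cond (I : eqType) (s : seq I) (Q : pred I)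
    (F : I -> T -> R) :
  (forall i, measurable_fun setT (F i)) ->
  measurable_fun setT (fun w => \prod_(i <- s | Q i) F i w).
Proof.
move=> mF; rewrite (_ : (fun w => _) =
    fun w => \prod_(i <- s) if Q i then F i w else 1).
  by apply: measurable_prod => i _; case: (Q i).
by apply/funext => w; rewrite big_mkcond.
Qed.

Lemma integrable_ge0_fin X c : measurable_fun setT X -> (forall w, 0 <= X w) ->
  (\int[P]_w (X w)%:E)%E = c%:E -> P.-integrable setT (EFin \o X).
Proof.
move=> mX X0 eX; apply/integrableP; split; first exact/measurable_EFinP.
under eq_integral do rewrite /= ger0_norm //.
by rewrite eX ltry.
Qed.
End Expectation.

(** * Products of nonnegative functions of independent variables *)

Section Independence.
Context {d : measure_display} {T : measurableType d} {R : realType}.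
Variables (P : probability T R) (Ys : nat -> {RV P >-> R}).
Hypothesis indep : mutually_independent P (fun j => Ys j : T -> R).

(* The independence assumption covers [q = 0]; the indicators are replaced by
   the [g p] one at a time, since for fixed other factors the identity for all
   indicators of one variable extends to nonnegative measurable functions. *)
Let hybrid (g : nat -> R -> R) (B : nat -> set R) q p x : R :=
  if (p < q)%N then g p x else \1_(B p) x.

Lemma integral_prod_indic (B : nat -> set R) k :
  (forall j, measurable (B j)) ->
  (\int[P]_w (\prod_(p < k) \1_(B p) (Ys p w))%:E =
    (\prod_(p < k) Er P (fun w => \1_(B p) (Ys p w)))%:E)%E.
Proof.
move=> mB; have mYB p : measurable (Ys p @^-1` B p).
  by rewrite -[X in measurable X]setTI; apply: measurable_funP.
pose J := index_iota 0 k.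
have eqI w : \prod_(p < k) \1_(B p) (Ys p w) =
    \1_(\big[setI/setT]_(j <- J) (Ys j @^-1` B j)) w :> R.
  rewrite -(big_mkord xpredT (fun p => \1_(B p) (Ys p w))) -/J.
  elim: J => [|j J IHJ]; first by rewrite !big_nil indicT.
  by rewrite !big_cons indicI IHJ.
under eq_integral do rewrite eqI.
rewrite integral_indic ?setIT //; last exact: bigsetI_measurable.
transitivity (\prod_(j <- J) P (Ys j @^-1` B j))%E.
  exact: indep (iota_uniq _ _) mB.
rewrite /J big_mkord -prodEFin; apply: eq_bigr => p _.
exact/esym/(Er_indic P (mYB p)).
Qed.

Variable g : nat -> R -> R.
Hypothesis mg : forall p, measurable_fun setT (g p).
Hypothesis g0 : forall p x, 0 <= g p x.
Hypothesis ig : forall p, P.-integrable setT (EFin \o (fun w => g p (Ys p w))).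

Let ihybrid B q p : (forall j, measurable (B j)) ->
  P.-integrable setT (EFin \o (fun w => hybrid g B q p (Ys p w))).
Proof.
move=> mB; rewrite /hybrid; case: (p < q)%N => //.
rewrite (_ : (fun w => _) = \1_(Ys p @^-1` B p)) //.
apply: integrable_indic => //.
by rewrite -[X in measurable X]setTI; apply: measurable_funP.
Qed.

Let mhybrid B q p : (forall j, measurable (B j)) ->
  measurable_fun setT (fun w => hybrid g B q p (Ys p w)).
Proof.
by move=> mB; apply/measurable_EFinP; case/integrableP: (@ihybrid B q p mB).
Qed.

Let hybrid0 B q p x : 0 <= hybrid g B q p x.
Proof. by rewrite /hybrid; case: ifP. Qed.

(** Induction on [q] for all [B] at once, since the step uses the previous identity with the set of
    index [q] replaced by an arbitrary measurable one. *)
Lemma integral_prod_hybrid k q (B : nat -> set R) :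
  (forall j, measurable (B j)) ->
  (\int[P]_w (\prod_(p < k) hybrid g B q p (Ys p w))%:E =
    (\prod_(p < k) Er P (fun w => hybrid g B q p (Ys p w)))%:E)%E.
Proof.
elim: q B => [|q IHq] B mB; first exact: (integral_prod_indic k mB).
(* If [k <= q], every factor has already been replaced. *)
have [leqk|ltqk] := leqP k q.
  have eqh w (p : 'I_k) : hybrid g B q.+1 p w = hybrid g B q p w.
    have ltpq : (p < q)%N by exact: leq_trans leqk.
    by rewrite /hybrid ltnS (ltnW ltpq) ltpq.
  under eq_integral do under eq_bigr do rewrite eqh.
  rewrite IHq //; congr (_%:E); apply: eq_bigr => p _.
  by congr (Er P _); apply/funext => w; rewrite eqh.
pose q' := Ordinal ltqk.
pose B' C p := if p == q then C else B p.
have mB' C : measurable C -> forall j, measurable (B' C j).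
  by move=> mC j; rewrite /B'; case: ifP.
have eqh C w (p : 'I_k) : p != q' ->
    hybrid g B q.+1 p w = hybrid g (B' C) q p w.
  rewrite -(inj_eq val_inj) /= => neq.
  by rewrite /hybrid /B' (negbTE neq) ltnS leq_eqVlt (negbTE neq).
have eqC C w : hybrid g (B' C) q q w = \1_C w by rewrite /hybrid ltnn /B' eqxx.
have eqq w : hybrid g B q.+1 q w = g q w by rewrite /hybrid ltnSn.
under eq_integral do rewrite (bigD1 q') //= eqq.
rewrite (bigD1 q') //= EFinM -ErE; last exact: (@ihybrid B q.+1 q mB).
under [in RHS]eq_integral do rewrite eqq.
pose Z w := \prod_(i < k | i != q') hybrid g B q.+1 i (Ys i w).
apply: (ge0_integral_comp_indep (Z := Z)) => //.
- by move=> w; apply: prodr_ge0 => p _; exact: hybrid0.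
- by apply: measurable_prod_cond => p; exact: (@mhybrid B q.+1 p mB).
- by apply: prodr_ge0 => p _; rewrite fine_ge0 // expectation_ge0.
(* With the factor of index [q] split off, the induction hypothesis for [B' C] is the identity
   required for the indicator of [C]. *)
move=> C mC; have := IHq _ (mB' C mC).
under eq_integral do rewrite (bigD1 q') //= eqC.
rewrite (bigD1 q') //= EFinM -ErE; last exact: (@ihybrid (B' C) q q (mB' C mC)).
under [X in _ = (X * _)%E]eq_integral do rewrite eqC.
rewrite [X in _ = (X * _)%E](_ : _ = P (Ys q @^-1` C)); last first.
  rewrite (_ : (fun w => _) = (fun w => (\1_(Ys q @^-1` C) w)%:E)) //.
  rewrite integral_indic ?setIT //.
  by rewrite -[X in measurable X]setTI; apply: measurable_funP.
move=> IH; transitivity (\int[P]_x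
    (\1_C (Ys q x) *
       \prod_(i < k | i != q') hybrid g (B' C) q i (Ys i x))%:E)%E.
  apply: eq_integral => w _; congr (_ * _)%:E.
  by apply: eq_bigr => p np; rewrite (eqh C).
rewrite IH; congr (_ * _%:E)%E; apply: eq_bigr => p np.
by congr (Er P _); apply/funext => w; rewrite (eqh C).
Qed.

Let hybridE k B p : (p < k)%N ->
  (fun w => hybrid g B k p (Ys p w)) = (fun w => g p (Ys p w)).
Proof. by move=> ltpk; apply/funext => w; rewrite /hybrid ltpk. Qed.

Lemma integral_prod_ge0 k :
  (\int[P]_w (\prod_(p < k) g p (Ys p w))%:E =
    (\prod_(p < k) Er P (fun w => g p (Ys p w)))%:E)%E.
Proof.
have := @integral_prod_hybrid k k (fun=> setT) (fun=> measurableT).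
under eq_integral do under eq_bigr do rewrite /hybrid ltn_ord.
by move=> ->; congr (_%:E); apply: eq_bigr => p _; rewrite hybridE.
Qed.

Lemma integrable_prod_ge0 k :
  P.-integrable setT (EFin \o (fun w => \prod_(p < k) g p (Ys p w))).
Proof.
apply: integrable_ge0_fin (integral_prod_ge0 k).
  by apply: measurable_prod_cond => p; exact: measurableT_comp.
by move=> w; exact: prodr_ge0.
Qed.

Lemma Er_prod_ge0 k : Er P (fun w => \prod_(p < k) g p (Ys p w)) =
  \prod_(p < k) Er P (fun w => g p (Ys p w)).
Proof. by rewrite {1}/Er unlock integral_prod_ge0. Qed.
End Independence.

(** * Products of signed functions of independent variables *)

Section IndependentProduct.
Context {d : measure_display} {T : measurableType d} {R : realType}.
Variables (P : probability T R) (Ys : nat -> {RV P >-> R}).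
Hypothesis indep : mutually_independent P (fun j => Ys j : T -> R).
Variable g : nat -> R -> R.
Hypothesis mg : forall p, measurable_fun setT (g p).
Hypothesis ig : forall p, P.-integrable setT (EFin \o (fun w => g p (Ys p w))).

(* Splitting every factor into its positive and negative parts and expanding
   over all sign patterns reduces to nonnegative factors. *)
Let part (b : bool) p x : R := if b then (g p)^\- x else (g p)^\+ x.

Let partE p x : g p x = \sum_(b : bool) (-1) ^+ b * part b p x.
Proof.
rewrite big_bool /= expr1 expr0 mul1r mulN1r addrC.
by rewrite -[in LHS](funrposBneg (g p)).
Qed.

Let mpart (s : nat -> bool) p : measurable_fun setT (part (s p) p).
Proof.
rewrite /part; case: (s p); first exact: measurable_funrneg.
exact: measurable_funrpos.
Qed.

Let part0 (s : nat -> bool) p x : 0 <= part (s p) p x.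
Proof.
by rewrite /part; case: (s p); [exact: funrneg_ge0|exact: funrpos_ge0].
Qed.

Let ipart (s : nat -> bool) p :
  P.-integrable setT (EFin \o (fun w => part (s p) p (Ys p w))).
Proof.
rewrite /part; case: (s p).
  exact: (integrable_funrneg measurableT (ig p)).
exact: (integrable_funrpos measurableT (ig p)).
Qed.

(** The nonnegative case takes families indexed by [nat], so a sign pattern on [k] indices is
    extended by [false]; only the indices below [k] enter the products. *)
Let ext k (s : {ffun 'I_k -> bool}) (p : nat) : bool :=
  if insub p is Some i then s i else false.

Let extE k (s : {ffun 'I_k -> bool}) (p : 'I_k) : ext s p = s p.
Proof. by rewrite /ext valK. Qed.

Let expand k w : \prod_(p < k) g p (Ys p w) =
  \sum_(s : {ffun 'I_k -> bool})
    (\prod_(p < k) (-1) ^+ s p) * \prod_(p < k) part (ext s p) p (Ys p w).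
Proof.
under eq_bigr do rewrite partE.
rewrite bigA_distr_bigA; apply: eq_bigr => s _; rewrite -big_split.
by apply: eq_bigr => p _; rewrite extE.
Qed.

Let iterm k (s : {ffun 'I_k -> bool}) : P.-integrable setT
  (EFin \o (fun w => \prod_(p < k) part (ext s p) p (Ys p w))).
Proof. exact: (integrable_prod_ge0 indep (mpart _) (part0 _) (ipart _)). Qed.

Let iterm' k (s : {ffun 'I_k -> bool}) : P.-integrable setT
  (EFin \o (fun w => (\prod_(p < k) (-1) ^+ s p) *
                     \prod_(p < k) part (ext s p) p (Ys p w))).
Proof. exact: (integrableZl _ _ (iterm s)). Qed.

Lemma integrable_prod_indep k :
  P.-integrable setT (EFin \o (fun w => \prod_(p < k) g p (Ys p w))).
Proof.
rewrite (_ : _ \o _ = fun w => (\sum_(s : {ffun 'I_k -> bool})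
    (EFin \o (fun w => (\prod_(p < k) (-1) ^+ s p) *
                     \prod_(p < k) part (ext s p) p (Ys p w))%R) w)%E).
  by apply: integrable_sum => // s _; exact: iterm'.
by apply/funext => w; rewrite /= expand sumEFin.
Qed.

Lemma Er_prod_indep k : Er P (fun w => \prod_(p < k) g p (Ys p w)) =
  \prod_(p < k) Er P (fun w => g p (Ys p w)).
Proof.
rewrite (_ : (fun w => _) = fun w => \sum_(s : {ffun 'I_k -> bool})
    (\prod_(p < k) (-1) ^+ s p) * \prod_(p < k) part (ext s p) p (Ys p w));
  last first.
  by apply/funext => w; exact: expand.
rewrite Er_sum; last exact: iterm'.
(* The product of these one-variable splittings expands over the same sign patterns as the left
   side. *)
have Epart p : Er P (fun w => g p (Ys p w)) =
    \sum_(b : bool) (-1) ^+ b * Er P (fun w => part b p (Ys p w)).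
  rewrite (_ : (fun w => _) =
      fun w => \sum_(b : bool) (-1) ^+ b * part b p (Ys p w)); last first.
    by apply/funext => w; exact: partE.
  rewrite Er_sum => [|b].
    by apply: eq_bigr => b _; rewrite Er_scale //; exact: (ipart (fun=> b)).
  exact: (integrableZl _ _ (ipart (fun=> b) p)).
under [RHS]eq_bigr do rewrite Epart.
rewrite bigA_distr_bigA; apply: eq_bigr => s _.
rewrite Er_scale; last exact: iterm.
rewrite (Er_prod_ge0 indep (mpart _) (part0 _) (ipart _)) -big_split.
by apply: eq_bigr => p _; rewrite extE.
Qed.
End IndependentProduct.

Lemma exprn_le_expR (R : realType) (x : R) n :
  0 <= x -> x ^+ n <= n`!%:R * expR x.
Proof.
move=> x0; case: n => [|n].
  by rewrite expr0 mul1r -expR0 ler_expR.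
rewrite mulrC -ler_pdivrMr ?ltr0n ?fact_gt0 //.
by apply: le_trans (expR_ge1Dxn n x0); rewrite lerDr.
Qed.

(** * Existence of moments and transfer along equality in law *)

Section Moments.
Context {d : measure_display} {T : measurableType d} {R : realType}.
Variable P : probability T R.

(** Domination: for [t > 0], $|Y|^n \le n!\,t^{-n} e^{t|Y|} \le n!\,t^{-n}(e^{tY}+e^{-tY})$. The
    choice [r0 / 2] keeps both [t] and [- t] inside the interval. *)
Lemma mgf_integrable_moment (Y : {RV P >-> R}) n :
  mgf_exists_near0 P Y -> P.-integrable setT (EFin \o (fun w => Y w ^+ n)).
Proof.
move=> [r0 [r0_gt0 mgfY]]; pose t := r0 / 2.
have t0 : 0 < t by rewrite divr_gt0.
have tr0 : `|t| < r0 by rewrite gtr0_norm // /t; lra.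
have Ntr0 : `|- t| < r0 by rewrite normrN.
have iD := integrableD measurableT (mgfY t tr0) (mgfY (- t) Ntr0).
apply: (le_integrable measurableT _ _
  (integrableZl measurableT (n`!%:R / t ^+ n) iD)).
  by apply/measurable_EFinP; exact: measurable_funX.
move=> w _ /=; rewrite lee_fin normrX; apply: le_trans (ler_norm _).
rewrite mulrAC ler_pdivlMr ?exprn_gt0 // -exprMn mulrC.
rewrite -[X in X * _](gtr0_norm t0) -normrM.
apply: (le_trans (exprn_le_expR n (normr_ge0 _))).
rewrite ler_wpM2l // mulNr; case: (ger0P (t * Y w)) => _.
  by rewrite lerDl expR_ge0.
by rewrite lerDr expR_ge0.
Qed.

Section SameLaw.
Variables X Y : {RV P >-> R}.
Hypothesis sXY : same_law P X Y.
Variable f : R -> R.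
Hypothesis mf : measurable_fun setT f.

Lemma same_law_integrable :
  P.-integrable setT (EFin \o (fun w => f (Y w))) ->
  P.-integrable setT (EFin \o (fun w => f (X w))).
Proof.
move=> /integrableP[_ iY]; apply/integrableP; split.
  by apply/measurable_EFinP; exact: measurableT_comp.
pose Ef x := `|(f x)%:E|%E.
have mEf : measurable_fun setT Ef.
  by apply: measurableT_comp => //; exact/measurable_EFinP.
have Ef0 x : (0 <= Ef x)%E by exact: abse_ge0.
move: iY; rewrite -(@ge0_integral_distribution _ _ _ _ _ P Y Ef) //.
rewrite -(@ge0_integral_distribution _ _ _ _ _ P X Ef) //.
by rewrite (eq_measure_integral (distribution P X)) // => B mB _;
  exact/esym/sXY.
Qed.

Lemma same_law_Er : P.-integrable setT (EFin \o (fun w => f (Y w))) ->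
  Er P (fun w => f (X w)) = Er P (fun w => f (Y w)).
Proof.
move=> iY; have iX := same_law_integrable iY.
have mEf : measurable_fun setT (fun x => (f x)%:E) by exact/measurable_EFinP.
rewrite /Er unlock; congr fine.
rewrite -(@integral_distribution _ _ _ _ _ P Y (fun x => (f x)%:E)) //.
rewrite -(@integral_distribution _ _ _ _ _ P X (fun x => (f x)%:E)) //.
by apply: eq_measure_integral => B mB _; exact: sXY.
Qed.
End SameLaw.
End Moments.

(** * Comparison of coefficients *)

Lemma iter_hshiftE (A : comNzRingType) (a : hurwitz A) m n :
  iter m (@hshift A) a n = a (m + n)%N.
Proof.
by elim: m n => [//|m IHm] n; rewrite iterS [LHS]IHm addSnnS.
Qed.

(** Both sides are the coefficient of $t^q/q!$ in $\prod_p v_p^{l_p} e^{v_p t}$. *)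
Lemma sum_expr_prod_expr (R : comNzRingType) k (v : 'I_k -> R)
    (l : 'I_k -> nat) q :
  (\sum_p v p) ^+ q * \prod_p v p ^+ l p =
  \sum_(a : {ffun 'I_k -> 'I_q.+1} | (\sum_(p < k) (a p : nat) == q)%N)
    (q`! %/ \prod_(p < k) (a p)`!)%:R * \prod_p v p ^+ (l p + a p).
Proof.
transitivity ((\prod_p (hconst (v p ^+ l p) * hexp (v p))) q).
  by rewrite big_split /= -rmorph_prod -hexp_sum hconst_mulE mulrC.
rewrite hurwitz_prod_coef; apply: eq_bigr => a _; congr (_ * _).
by apply: eq_bigr => p _; rewrite hconst_mulE /hexp exprD.
Qed.

(** * Mixed moments and powers of the increment *)

Section MixedMoments.
Context {d : measure_display} {T : measurableType d} {R : realType}.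
Variables (P : probability T R) (Y : {RV P >-> R}) (Ys : nat -> {RV P >-> R}).
Hypothesis mgfY : mgf_exists_near0 P Y.
Hypothesis indep : mutually_independent P (fun j => Ys j : T -> R).
Hypothesis sameY : forall j, same_law P (Ys j) Y.

Definition moment : hurwitz R := fun n => Er P (fun w => Y w ^+ n).

Lemma moment0 : moment 0%N = 1.
Proof.
rewrite /moment /Er; under [X in expectation P X]eq_fun do rewrite expr0.
by rewrite expectation_cst.
Qed.

Section Exponents.
Variables (k : nat) (e : 'I_k -> nat).

Let g (p : nat) (x : R) : R := x ^+ (if insub p is Some i then e i else 0%N).

Let gE (p : 'I_k) x : g p x = x ^+ e p. Proof. by rewrite /g valK. Qed.

Let mg p : measurable_fun setT (g p).
Proof. exact: exprn_measurable. Qed.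

Let ig p : P.-integrable setT (EFin \o (fun w => g p (Ys p w))).
Proof.
exact: (same_law_integrable (sameY p) (mg p) (mgf_integrable_moment _ mgfY)).
Qed.

Lemma integrable_prod_moment :
  P.-integrable setT (EFin \o (fun w => \prod_(p < k) Ys p w ^+ e p)).
Proof.
rewrite (_ : (fun w => _) = (fun w => \prod_(p < k) g p (Ys p w))).
  exact: integrable_prod_indep.
by apply/funext => w; apply: eq_bigr => p _; rewrite gE.
Qed.

Lemma Er_prod_moment :
  Er P (fun w => \prod_(p < k) Ys p w ^+ e p) = \prod_(p < k) moment (e p).
Proof.
rewrite (_ : (fun w => _) = (fun w => \prod_(p < k) g p (Ys p w))); last first.
  by apply/funext => w; apply: eq_bigr => p _; rewrite gE.
rewrite Er_prod_indep //; apply: eq_bigr => p _.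
rewrite (same_law_Er (sameY p) (mg p)); last exact: mgf_integrable_moment.
by congr (Er P _); apply/funext => w; rewrite gE.
Qed.
End Exponents.

(** Shifting the moments by [l p] gives the series of $E[Y^{l_p} e^{tY}]$; by independence the
    product of these is $E[e^{S_k t}\prod_p Y_p^{l_p}]$. Both sides are expanded multinomially and
    compared term by term. *)
Lemma mixed_momentE k (l : 'I_k -> nat) q :
  Er P (fun w => (\sum_(p < k) Ys p w) ^+ q * \prod_(p < k) Ys p w ^+ l p) =
  (\prod_(p < k) iter (l p) (@hshift R) moment) q.
Proof.
under [X in Er P X]eq_fun do rewrite (sum_expr_prod_expr (fun p => Ys p _)).
rewrite Er_sum => [|a]; last first.
  exact: (integrableZl _ _ (integrable_prod_moment _)).
rewrite hurwitz_prod_coef; apply: eq_bigr => a _.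
rewrite Er_scale; last exact: integrable_prod_moment.
rewrite Er_prod_moment; congr (_ * _).
by apply: eq_bigr => p _; rewrite iter_hshiftE.
Qed.

Variable y : R.

(** The series $u = y(f-1)$. *)
Definition scaled_mgf : hurwitz R :=
  hurwitz_of_fps (fscale y (fsub (mgf_series P Y) (fone R))).

Lemma scaled_mgf0 : scaled_mgf 0%N = 0.
Proof.
rewrite /scaled_mgf /hurwitz_of_fps /fscale /fsub /mgf_series -/(moment 0).
by rewrite moment0 divr1 subrr !mulr0.
Qed.

Lemma scaled_mgfS n : scaled_mgf n.+1 = y * moment n.+1.
Proof.
rewrite /scaled_mgf /hurwitz_of_fps /fscale /fsub /mgf_series -/(moment n.+1).
by rewrite /fone subr0 mulrCA (mulrC _`!%:R) divfK // pnatr_eq0 -lt0n fact_gt0.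
Qed.

Lemma hincr_scaled_mgfS n :
  hincr scaled_mgf n.+1 = hconst y * iter n.+1 (@hshift R) moment.
Proof.
apply/funext => q; rewrite hconst_mulE -[hincr _ _]/(iter n.+1 (@hshift R) _).
by rewrite !iter_hshiftE addSn scaled_mgfS.
Qed.

Lemma hincrX_scaled_mgf k j q :
  (hincr scaled_mgf ^+ k) j q =
  y ^+ k * \sum_(l : {ffun 'I_k -> 'I_j.+1} |
             (\sum_(p < k) (l p : nat) == j)%N && [forall p, (0 < l p)%N])
    (multinom l)%:R *
    Er P (fun w => (\sum_(p < k) Ys p w) ^+ q * \prod_(p < k) Ys p w ^+ l p).
Proof.
rewrite -{1}[k]card_ord -prodr_const hurwitz_prod_coef hurwitz_sum.
rewrite mulr_sumr big_mkcond [RHS]big_mkcond; apply: eq_bigr => l _.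
case: eqP => //= _; case: forallP => [l0|/forallP].
  rewrite hurwitz_natl mulrCA mixed_momentE; congr (_ * _).
  transitivity ((\prod_(p < k) (hconst y * iter (l p) (@hshift R) moment)) q).
    congr ((_ : hurwitz R) q); apply: eq_bigr => p _.
    by case: (nat_of_ord (l p)) (l0 p) => // n _; exact: hincr_scaled_mgfS.
  by rewrite big_split /= prodr_const card_ord -rmorphXn hconst_mulE.
(* The increment has no term of order zero in $s$, so a tuple with some [l p = 0] contributes
   nothing; hence the positivity condition. *)
rewrite negb_forall => /existsP[p]; rewrite -eqn0Ngt => /eqP lp0.
by rewrite [X in _ * X](bigD1 p) //= lp0 hincr0 mul0r mulr0 hurwitz0.
Qed.

Lemma phiE r n x : phi P Y r n x y = hbinexp scaled_mgf r%:R x n.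
Proof.
by rewrite /hbinexp -hurwitz_of_fbinpow -hurwitz_of_fexp -hurwitz_of_fpsM.
Qed.
End MixedMoments.

(* Ys j stands for Y_{j+1}; S_k = Ys 0 + ... + Ys (k-1). *)
Theorem theorem2p4 (d : measure_display) (T : measurableType d) (R : realType)
    (P : probability T R) (Y : {RV P >-> R}) (Ys : nat -> {RV P >-> R})
    (r : nat) :
  mgf_exists_near0 P Y ->
  mutually_independent P (fun j => Ys j : T -> R) ->
  (forall j, same_law P (Ys j) Y) ->
  (0 < r)%N ->
  forall (m n : nat) (x y : R),
    phi P Y r (m + n) x y =
    \sum_(i < n.+1) \sum_(k < m.+1)
      ('C(n, i))%:R * phi P Y r i (x - k%:R) y *
      (falling x k * y ^+ k / (k`!)%:R) *
      \sum_(j < m.+1 | (k <= j)%N)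
        \sum_(l : {ffun 'I_k -> 'I_j.+1} |
                (\sum_(p < k) (l p : nat) == j)%N && [forall p, (0 < l p)%N])
          ('C(m, j))%:R * (multinom l)%:R * (r%:R) ^+ (m - j) *
          Er P (fun w => (\sum_(p < k) Ys p w) ^+ (n - i) *
                         \prod_(p < k) Ys p w ^+ (l p)).
Proof.
move=> mgfY indep sameY _ m n x y.
pose u := scaled_mgf Y y; have u0 : u 0%N = 0 by exact: scaled_mgf0.
(* The coefficient of index [m + n] is the coefficient of index [n] of the [m]-th derivative. *)
rewrite phiE -/u -(iter_hshiftE (hbinexp u r%:R x)) iter_hshift_hbinexp //.
rewrite hurwitz_sum.
under eq_bigr => k _ do rewrite hconst_mulE hurwitzM mulr_sumr.
rewrite exchange_big; apply: eq_bigr => i _; apply: eq_bigr => k _ /=.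
rewrite phiE -/u.
set S := \sum_(j < m.+1 | _) _.
suff <- : y ^+ k * S = hincrpow u r%:R k m (n - i)%N.
  by rewrite /binr; ring.
rewrite /hincrpow hurwitzM hurwitz_sum mulr_sumr big_mkcond.
apply: eq_bigr => j _; rewrite /hexp -(rmorphXn (@hconst R)) /= hurwitz_natl.
rewrite (mulrC ((hincr u ^+ k) j)) hconst_mulE.
(* The terms with [j < k] vanish by the order of the [k]-th power of the increment, which accounts
   for the restriction [k <= j]. *)
case: ifPn => [_|]; last first.
  rewrite -ltnNge => ltjk.
  by rewrite (hurwitzX_small _ ltjk) // hurwitz0 !mulr0.
rewrite (hincrX_scaled_mgf mgfY indep sameY) !mulr_sumr.
by apply: eq_bigr => l _; ring.
Qed.
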